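(* Let $\gamma\in\mathbb{N}$ and let $u^{(1)},\ldots,u^{(\gamma)}$ be $\mathbb{R}$-linearly independent vectors in $\mathbb{R}^{\mathbb{N}}$. For every hyperfinite $K>\mathbb{N}$, the vectors $(u^{(1)})_{(K)},\ldots,(u^{(\gamma)})_{(K)}$ are ${}^*\mathbb{R}$-linearly independent. As a consequence, $(u^{(1)})_{(m)},\ldots,(u^{(\gamma)})_{(m)}$ are $\mathbb{R}$-linearly independent for all large $m\in\mathbb{N}$.
   Context: $\mathbb{R}^{\mathbb{N}}$ is the vector space of all real sequences. For $x=(x_1,x_2,\ldots)\in\mathbb{R}^{\mathbb{N}}$ and $n\in\mathbb{N}$, $x_{(n)}=(x_1,\ldots,x_n)\in\mathbb{R}^n$. We fix a sufficiently saturated nonstandard extension of a superstructure containing the standard objects under study; ${}^*A$ denotes the nonstandard extension of $A$. ''$K>\mathbb{N}$'' (hyperfinite) means $K\in{}^*\mathbb{N}\setminus\mathbb{N}$. For such $K$, $x_{(K)}\in{}^*\mathbb{R}^K$ is the internal truncation to the first $K$ coordinates of the nonstandard extension of the sequence $x$. *)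

(* Defs.v *)
From HB Require Import structures.
From mathcomp Require Import all_boot all_order all_algebra.
From mathcomp Require Import all_classical all_reals all_analysis.

Set Implicit Arguments.
Unset Strict Implicit.
Unset Printing Implicit Defensive.

Import Order.TTheory GRing.Theory Num.Theory.

Local Open Scope classical_set_scope.
Local Open Scope ring_scope.

(* [free] only covers finite-dimensional spaces, hence not R^N *)
Definition lin_indep (F : pzRingType) (V : lmodType F) (n : nat)
    (v : 'I_n -> V) : Prop :=
  forall c : 'I_n -> F, \sum_(i < n) c i *: v i = 0 -> forall i, c i = 0.

(* V_0(X) = X and V_{n+1}(X) = V_n(X) \cup P(V_n(X)). *)
Fixpoint stage (X V : Type) (atom : X -> V) (elt : V -> V -> Prop) (n : nat)
    : set V :=
  if n is n'.+1 then
    stage atom elt n' `|`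
    [set a | ~ range atom a /\ forall x, elt x a -> stage atom elt n' x]
  else range atom.

(* The superstructure V(X) = \bigcup_n V_n(X), described by axioms that
   determine it up to a unique isomorphism fixing X. *)
Record superstructure (X : Type) := Superstructure {
  entity :> Type;
  atom : X -> entity;
  elt : entity -> entity -> Prop;
  atom_inj : injective atom;
  atom_noelt : forall a x, ~ elt a (atom x);
  set_ext : forall a b, ~ range atom a -> ~ range atom b ->
    (forall x, elt x a <-> elt x b) -> a = b;
  stage_powerset : forall n (A : set entity), A `<=` stage atom elt n ->
    exists a, ~ range atom a /\ forall x, elt x a <-> A x;
  ranked : forall a, exists n, stage atom elt n a }.

Arguments atom {X s}.
Arguments elt {X s}.

Section SetsInSuperstructure.
Variables (X : Type) (V : superstructure X).
Implicit Types (a b c s t x y : V) (A : set V).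

Definition bounded_rank A := exists n, A `<=` stage atom elt n.

Lemma set_of_subproof A (hA : bounded_rank A) :
  exists a, ~ range atom a /\ forall x, elt x a <-> A x.
Proof. by have [n /stage_powerset] := hA. Qed.

Definition set_of A (hA : bounded_rank A) : V := projT1 (cid (set_of_subproof hA)).

Lemma elt_set_of A (hA : bounded_rank A) x : elt x (set_of hA) <-> A x.
Proof. by rewrite /set_of; case: cid => a /= [_]. Qed.

Lemma set_of_nonatom A (hA : bounded_rank A) : ~ range atom (set_of hA).
Proof. by rewrite /set_of; case: cid => a /= []. Qed.

Lemma stage_le m n : (m <= n)%N -> stage (@atom X V) elt m `<=` stage atom elt n.
Proof.
move=> /subnK <-; elim: (n - m)%N => [//|k IH] x /IH hx.
by rewrite addSn /=; left.
Qed.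

Lemma bounded_rank2 a b : bounded_rank [set a; b].
Proof.
have [[m ha] [n hb]] := (ranked a, ranked b).
exists (maxn m n) => x [->|->].
  exact: stage_le (leq_maxl _ _) _ ha.
exact: stage_le (leq_maxr _ _) _ hb.
Qed.

Definition upair a b : V := set_of (bounded_rank2 a b).

(* Kuratowski pair *)
Definition opair a b : V := upair (upair a a) (upair a b).

Lemma elt_upair a b x : elt x (upair a b) <-> (x = a \/ x = b).
Proof. by rewrite elt_set_of. Qed.

Lemma elt_nonatom x s : elt x s -> ~ range atom s.
Proof. by move=> xs [y _ ys]; rewrite -ys in xs; exact: atom_noelt xs. Qed.

Lemma upairP s a b : s = upair a b <->
  elt a s /\ elt b s /\ forall w, elt w s -> w = a \/ w = b.
Proof.
split=> [->|[as_ [bs ws]]].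
  by split; [|split=> [|w]]; rewrite elt_upair; auto.
apply: set_ext.
- exact: elt_nonatom as_.
- exact: set_of_nonatom.
- move=> x; split=> [/ws ?|]; first by rewrite elt_upair.
  by rewrite elt_upair => -[]->.
Qed.

Lemma upair_inj a b c : upair a b = upair a c -> b = c.
Proof.
move=> /upairP [_ [+ h]]; rewrite elt_upair => -[ca|//].
have /h : elt b (upair a b) by rewrite elt_upair; right.
by rewrite ca => -[].
Qed.

Lemma opair_inj a b c d : opair a b = opair c d -> a = c /\ b = d.
Proof.
move=> h; have ac : a = c.
  have : elt (upair a a) (opair c d) by rewrite -h elt_upair; left.
  rewrite elt_upair => -[] e.
    have : elt a (upair c c) by rewrite -e elt_upair; left.
    by rewrite elt_upair; case.
  have : elt c (upair a a) by rewrite e elt_upair; left.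
  by rewrite elt_upair; case.
by split=> //; move: h; rewrite ac => /upair_inj/upair_inj.
Qed.

Lemma stage_upair n a b : stage atom elt n a -> stage atom elt n b ->
  stage atom elt n.+1 (upair a b).
Proof.
move=> ha hb; right; split; first exact: set_of_nonatom.
by move=> x; rewrite elt_upair => -[]->.
Qed.

Lemma stage_opair n a b : stage atom elt n a -> stage atom elt n b ->
  stage atom elt n.+2 (opair a b).
Proof. by move=> ha hb; apply: stage_upair; apply: stage_upair. Qed.

End SetsInSuperstructure.

(* Formulas in the language {=, \in} in which every quantifier is of the form
   "for all x \in y"; variables are de Bruijn indices. *)
Inductive bformula : Type :=
| fEq of nat & nat
| fMem of nat & nat
| fNot of bformula
| fAnd of bformula & bformula
| fAll of nat & bformula.

Definition scons (T : Type) (x : T) (e : nat -> T) (i : nat) : T :=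
  if i is j.+1 then e j else x.

Fixpoint sat (X : Type) (V : superstructure X) (e : nat -> V) (f : bformula)
    : Prop :=
  match f with
  | fEq i j => e i = e j
  | fMem i j => elt (e i) (e j)
  | fNot g => ~ sat e g
  | fAnd g h => sat e g /\ sat e h
  | fAll i g => forall x, elt x (e i) -> sat (scons x e) g
  end.

Definition fImp f g := fNot (fAnd f (fNot g)).
Definition fOr f g := fNot (fAnd (fNot f) (fNot g)).
Definition fIff f g := fAnd (fImp f g) (fImp g f).
Definition fEx i f := fNot (fAll i (fNot f)).
(* s = {a, b} *)
Definition fUpair s a b :=
  fAnd (fMem a s) (fAnd (fMem b s)
    (fAll s (fOr (fEq 0 a.+1) (fEq 0 b.+1)))).
(* p = (a, b) *)
Definition fOpair p a b :=
  fEx p (fEx p.+1 (fAnd (fUpair 1 a.+2 a.+2)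
    (fAnd (fUpair 0 a.+2 b.+2) (fUpair p.+2 1 0)))).
(* (a, b) \in s *)
Definition fPairIn a b s := fEx s (fOpair 0 a.+1 b.+1).
(* ((a, b), c) \in s *)
Definition fTripleIn a b c s :=
  fEx s (fEx 0 (fEx 0 (fAnd (fOpair 0 a.+3 b.+3) (fOpair 2 0 c.+3)))).

Section SatLemmas.
Variables (X : Type) (V : superstructure X).
Implicit Types (e : nat -> V) (f g : bformula).

Lemma sat_imp e f g : sat e (fImp f g) <-> (sat e f -> sat e g).
Proof.
split=> /= [h hf|h [hf]]; last by apply; apply: h.
by apply: contrapT => hg; apply: h.
Qed.

Lemma sat_or e f g : sat e (fOr f g) <-> (sat e f \/ sat e g).
Proof.
split=> /= [h|[] h []//].
by apply: contrapT => /not_orP.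
Qed.

Lemma sat_iff e f g : sat e (fIff f g) <-> (sat e f <-> sat e g).
Proof.
split=> [[/sat_imp ? /sat_imp ?]//|[? ?]].
by split; apply/sat_imp.
Qed.

Lemma sat_ex e i f :
  sat e (fEx i f) <-> exists2 x, elt x (e i) & sat (scons x e) f.
Proof.
split=> /= [h|[x xi hf] /(_ x xi)//].
by apply: contrapT => h'; apply: h => x xi hf; apply: h'; exists x.
Qed.

Lemma sat_and e f g : sat e (fAnd f g) <-> (sat e f /\ sat e g).
Proof. by []. Qed.

Lemma sat_upair e s a b : sat e (fUpair s a b) <-> e s = upair (e a) (e b).
Proof.
rewrite upairP; split=> -[h1 [h2 h3]]; split=> //; split=> // w ws.
  exact: (proj1 (sat_or (scons w e) (fEq 0 a.+1) (fEq 0 b.+1)) (h3 w ws)).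
exact: (proj2 (sat_or (scons w e) (fEq 0 a.+1) (fEq 0 b.+1)) (h3 w ws)).
Qed.

Lemma sat_opair e p a b : sat e (fOpair p a b) <-> e p = opair (e a) (e b).
Proof.
rewrite /fOpair sat_ex; split.
  move=> [x _]; rewrite sat_ex => -[y _].
  by rewrite sat_and sat_upair sat_and !sat_upair /= => -[-> [->]].
move=> h; exists (upair (e a) (e a)); first by rewrite h elt_upair; left.
rewrite sat_ex; exists (upair (e a) (e b)).
  by rewrite /= h elt_upair; right.
by rewrite sat_and sat_upair sat_and !sat_upair.
Qed.

Lemma sat_pairin e a b t :
  sat e (fPairIn a b t) <-> elt (opair (e a) (e b)) (e t).
Proof.
rewrite /fPairIn sat_ex; split=> [[x xf]|h].
  by rewrite sat_opair /= => <-.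
by exists (opair (e a) (e b)) => //; rewrite sat_opair.
Qed.

Lemma sat_triplein e a b c t :
  sat e (fTripleIn a b c t) <-> elt (opair (opair (e a) (e b)) (e c)) (e t).
Proof.
rewrite /fTripleIn sat_ex; split.
  move=> [x xf]; rewrite sat_ex => -[s _]; rewrite sat_ex => -[q _].
  by rewrite sat_and !sat_opair /= => -[<- <-].
move=> h; exists (opair (opair (e a) (e b)) (e c)) => //.
rewrite sat_ex; exists (upair (opair (e a) (e b)) (opair (e a) (e b))).
  by rewrite /= elt_upair; left.
rewrite sat_ex; exists (opair (e a) (e b)).
  by rewrite /= elt_upair; left.
by rewrite sat_and !sat_opair.
Qed.

End SatLemmas.

(* Bounded formulas with set-theoretic pairing as a primitive, together with
   their translation into [bformula]. *)
Inductive pformula : Type :=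
| pEq of nat & nat
| pElt of nat & nat
| pIsPair of nat & nat & nat
| pPair of nat & nat & nat
| pTriple of nat & nat & nat & nat
| pNot of pformula
| pAnd of pformula & pformula
| pImp of pformula & pformula
| pIff of pformula & pformula
| pAll of nat & pformula
| pEx of nat & pformula.

Fixpoint psat (X : Type) (V : superstructure X) (e : nat -> V) (f : pformula)
    : Prop :=
  match f with
  | pEq i j => e i = e j
  | pElt i j => elt (e i) (e j)
  | pIsPair p a b => e p = opair (e a) (e b)
  | pPair a b s => elt (opair (e a) (e b)) (e s)
  | pTriple a b c s => elt (opair (opair (e a) (e b)) (e c)) (e s)
  | pNot g => ~ psat e g
  | pAnd g h => psat e g /\ psat e h
  | pImp g h => psat e g -> psat e h
  | pIff g h => psat e g <-> psat e h
  | pAll i g => forall x, elt x (e i) -> psat (scons x e) g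
  | pEx i g => exists2 x, elt x (e i) & psat (scons x e) g
  end.

Fixpoint bformula_of (f : pformula) : bformula :=
  match f with
  | pEq i j => fEq i j
  | pElt i j => fMem i j
  | pIsPair p a b => fOpair p a b
  | pPair a b s => fPairIn a b s
  | pTriple a b c s => fTripleIn a b c s
  | pNot g => fNot (bformula_of g)
  | pAnd g h => fAnd (bformula_of g) (bformula_of h)
  | pImp g h => fImp (bformula_of g) (bformula_of h)
  | pIff g h => fIff (bformula_of g) (bformula_of h)
  | pAll i g => fAll i (bformula_of g)
  | pEx i g => fEx i (bformula_of g)
  end.

Lemma sat_bformula_of (X : Type) (V : superstructure X) (f : pformula)
    (e : nat -> V) : sat e (bformula_of f) <-> psat e f.
Proof.
elim: f e => [i j|i j|p a b|a b s|a b c s|g IHg|g IHg h IHh|g IHg h IHh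
    |g IHg h IHh|i g IHg|i g IHg] e.
- by [].
- by [].
- exact: sat_opair.
- exact: sat_pairin.
- exact: sat_triplein.
- by rewrite /= IHg.
- by rewrite /= IHg IHh.
- by rewrite sat_imp IHg IHh.
- by rewrite sat_iff IHg IHh.
- by split=> /= H x /H/IHg.
- by rewrite sat_ex; split=> -[x xi /IHg]; exists x.
Qed.

(* [V(X)] for a base set [X] containing the reals. *)
Record real_superstructure (R : realType) := RealSuperstructure {
  base : Type;
  of_real : R -> base;
  of_real_inj : injective of_real;
  super :> superstructure base }.

Lemma bounded_rank_atoms (X : Type) (V : superstructure X) :
  bounded_rank (range (@atom X V)).
Proof. by exists 0%N. Qed.

(* the base set X as an element of V(X) *)
Definition base_set (X : Type) (V : superstructure X) : V :=
  set_of (bounded_rank_atoms V).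

(* A map *: V(X) -> V(Y), with Y = *X, satisfying the transfer principle. *)
Record nonstandard_extension (X : Type) (V : superstructure X) :=
  NonstandardExtension {
  ns_base : Type;
  ns_super :> superstructure ns_base;
  star : V -> ns_super;
  star_base : star (base_set V) = base_set ns_super;
  transfer : forall (f : bformula) (e : nat -> V),
    sat e f <-> sat (fun i => star (e i)) f }.

Arguments star {X V} n.

Definition internal (X : Type) (V : superstructure X)
    (E : nonstandard_extension V) (a : E) : Prop :=
  exists b : V, elt a (star E b).

(* Every countable family of internal sets with the finite intersection
   property has a common element. *)
Definition countably_saturated (X : Type) (V : superstructure X)
    (E : nonstandard_extension V) : Prop :=
  forall A : nat -> E, (forall i, internal (A i)) ->
    (forall n, exists x, forall i, (i < n)%N -> elt x (A i)) ->
    exists x, forall i, elt x (A i).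

Lemma ptransfer (X : Type) (V : superstructure X) (E : nonstandard_extension V)
    (f : pformula) (e : nat -> V) :
  psat e f -> psat (fun i => star E (e i)) f.
Proof. by move=> /sat_bformula_of/transfer/sat_bformula_of; apply. Qed.

Section StandardObjects.
Variables (R : realType) (V : real_superstructure R).
Implicit Types (f : R -> R -> R) (g : R -> R) (u : nat -> R).

Definition real (r : R) : V := atom (of_real V r).

Lemma real_inj : injective real.
Proof. exact: inj_comp (@atom_inj _ V) (@of_real_inj R V). Qed.

Lemma stage_real r : stage atom elt 0 (real r).
Proof. by exists (of_real V r). Qed.

Lemma bounded_rank_reals : bounded_rank (range real).
Proof. by exists 0%N => _ [r _ <-]; exact: stage_real. Qed.

Definition reals : V := set_of bounded_rank_reals.

Lemma bounded_rank_nats : bounded_rank (range (fun n : nat => real n%:R)).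
Proof. by exists 0%N => _ [n _ <-]; exact: stage_real. Qed.

Definition nats : V := set_of bounded_rank_nats.

Lemma bounded_rank_ltn : bounded_rank
  [set p | exists m n : nat, (m < n)%N /\ p = opair (real m%:R) (real n%:R)].
Proof.
by exists 2%N => _ [m [n [_ ->]]]; apply: stage_opair; exact: stage_real.
Qed.

Definition ltn_graph : V := set_of bounded_rank_ltn.

Lemma bounded_rank_fun1 g :
  bounded_rank (range (fun x => opair (real x) (real (g x)))).
Proof.
by exists 2%N => _ [x _ <-]; apply: stage_opair; exact: stage_real.
Qed.

Definition fun1_graph g : V := set_of (bounded_rank_fun1 g).

Lemma bounded_rank_fun2 f : bounded_rank
  (range (fun xy => opair (opair (real xy.1) (real xy.2)) (real (f xy.1 xy.2)))).
Proof.
exists 4%N => _ [[x y] _ <-]; apply: stage_opair.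
  by apply: stage_opair; exact: stage_real.
by apply: (stage_le (leq0n 2)); exact: stage_real.
Qed.

Definition fun2_graph f : V := set_of (bounded_rank_fun2 f).

Lemma bounded_rank_seq u :
  bounded_rank (range (fun n => opair (real n%:R) (real (u n)))).
Proof.
by exists 2%N => _ [n _ <-]; apply: stage_opair; exact: stage_real.
Qed.

Definition seq_graph u : V := set_of (bounded_rank_seq u).

Lemma bounded_rank_nat_real_rel :
  bounded_rank [set a : V | ~ range atom a /\
    forall p, elt p a -> exists n r, p = opair (real n%:R) (real r)].
Proof.
exists 3%N => a [anat ha]; right; split=> // p /ha[n [r ->]].
by apply: stage_opair; exact: stage_real.
Qed.

Definition nat_real_rels : V := set_of bounded_rank_nat_real_rel.

Lemma elt_reals x : elt x reals <-> exists r, x = real r.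
Proof.
rewrite elt_set_of; split=> [[r _ <-]|[r ->]]; first by exists r.
by exists r.
Qed.

Lemma elt_nats x : elt x nats <-> exists n : nat, x = real n%:R.
Proof.
rewrite elt_set_of; split=> [[r _ <-]|[r ->]]; first by exists r.
by exists r.
Qed.

Lemma elt_ltn m n :
  elt (opair (real m%:R) (real n%:R)) ltn_graph <-> (m < n)%N.
Proof.
rewrite elt_set_of /=; split=> [[m' [n' [h /opair_inj[/real_inj/eqP + /real_inj/eqP]]]]|h].
  by rewrite !eqr_nat => /eqP -> /eqP ->.
by exists m, n.
Qed.

Lemma elt_fun1 g x z :
  elt (opair (real x) z) (fun1_graph g) <-> z = real (g x).
Proof.
rewrite elt_set_of /=; split=> [[x' _ /opair_inj[/real_inj -> <-]]//|->].
by exists x.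
Qed.

Lemma elt_fun2 f x y z :
  elt (opair (opair (real x) (real y)) z) (fun2_graph f) <-> z = real (f x y).
Proof.
rewrite elt_set_of /=; split=> [|->]; last by exists (x, y).
by move=> [[x' y'] _ /opair_inj[/opair_inj[/real_inj /= -> /real_inj ->] <-]].
Qed.

Lemma elt_seq u n z :
  elt (opair (real n%:R) z) (seq_graph u) <-> z = real (u n).
Proof.
rewrite elt_set_of /=; split=> [[m _ /opair_inj[/real_inj/eqP + <-]]|->].
  by rewrite eqr_nat => /eqP ->.
by exists n.
Qed.

Lemma nat_real_rel_ex (P : nat -> R -> Prop) : exists2 a, elt a nat_real_rels &
  (forall p, elt p a -> exists n r, p = opair (real n%:R) (real r)) /\
  (forall n r, elt (opair (real n%:R) (real r)) a <-> P n r).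
Proof.
have hA : bounded_rank
    [set p : V | exists n r, P n r /\ p = opair (real n%:R) (real r)].
  by exists 2%N => _ [n [r [_ ->]]]; apply: stage_opair; exact: stage_real.
exists (set_of hA).
  rewrite elt_set_of; split; first exact: set_of_nonatom.
  by move=> p; rewrite elt_set_of => -[n [r [_ ->]]]; exists n, r.
split=> [p|n r]; rewrite elt_set_of /=; first by move=> [n [r [_ ->]]]; exists n, r.
split=> [[n' [r' [h /opair_inj[/real_inj/eqP + /real_inj ->]]]]|h].
  by rewrite eqr_nat => /eqP ->.
by exists n, r.
Qed.

End StandardObjects.

Definition params (X : Type) (V : superstructure X) (s : seq V) (i : nat) : V :=
  nth (base_set V) s i.

Section Hyperreals.
Variables (R : realType) (V : real_superstructure R).
Variable E : nonstandard_extension V.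
Implicit Types (f : R -> R -> R) (g : R -> R) (u : nat -> R).

Definition hyperreal : Type := {x : E | elt x (star E (reals V))}.

Definition hypernat : Type := {k : E | elt k (star E (nats V))}.

Lemma hyperreal_inj (x y : hyperreal) : sval x = sval y -> x = y.
Proof. by case: x y => [x hx] [y hy] /= h; exact: eq_exist. Qed.

Lemma star_real_subproof r : elt (star E (real V r)) (star E (reals V)).
Proof.
apply: (ptransfer E (f := pElt 0 1) (e := params [:: real V r; reals V])).
by apply/elt_reals; exists r.
Qed.

Definition star_real (r : R) : hyperreal := 
  exist (fun x : E => elt x (star E (reals V))) _ (star_real_subproof r).

Lemma star_nat_subproof n : elt (star E (real V n%:R)) (star E (nats V)).
Proof.
apply: (ptransfer E (f := pElt 0 1) (e := params [:: real V n%:R; nats V])).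
by apply/elt_nats; exists n.
Qed.

Definition star_nat (n : nat) : hypernat := 
  exist (fun k : E => elt k (star E (nats V))) _ (star_nat_subproof n).

(* K \in *N \ N, with N identified with its image under the star map *)
Definition hyperfinite (K : hypernat) : Prop := ~ exists n, K = star_nat n.

Lemma hfun1_subproof g (x : hyperreal) : exists z : hyperreal,
  forall y : hyperreal,
    elt (opair (sval x) (sval y)) (star E (fun1_graph V g)) <-> y = z.
Proof.
have /= := ptransfer E (f :=
  (pAll 0 (pEx 1 (pAll 2 (pIff (pPair 2 0 4) (pEq 0 1))))))
  (e := params [:: reals V; fun1_graph V g]).
move=> /(_ _ _ (svalP x)) [|z hz H].
  move=> _ /elt_reals[r ->]; exists (real V (g r)); first by apply/elt_reals; exists (g r).
  by move=> y _ /=; rewrite elt_fun1.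
exists (exist _ z hz) => y; rewrite (H _ (svalP y)).
by split=> [h|->//]; exact: hyperreal_inj.
Qed.

Lemma hfun2_subproof f (x y : hyperreal) : exists z : hyperreal,
  forall t : hyperreal,
    elt (opair (opair (sval x) (sval y)) (sval t)) (star E (fun2_graph V f)) <->
    t = z.
Proof.
have /= := ptransfer E (f :=
  (pAll 0 (pAll 1 (pEx 2 (pAll 3 (pIff (pTriple 3 2 0 5) (pEq 0 1)))))))
  (e := params [:: reals V; fun2_graph V f]).
move=> /(_ _ _ (svalP x) _ (svalP y)) [|z hz H].
  move=> _ /elt_reals[r ->] _ /elt_reals[s ->]; exists (real V (f r s)).
    by apply/elt_reals; exists (f r s).
  by move=> t _ /=; rewrite elt_fun2.
exists (exist _ z hz) => t; rewrite (H _ (svalP t)).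
by split=> [h|->//]; exact: hyperreal_inj.
Qed.

(* the extensions *g and *f of a unary and of a binary function on the reals *)
Definition hfun1 g (x : hyperreal) : hyperreal :=
  projT1 (cid (hfun1_subproof g x)).

Definition hfun2 f (x y : hyperreal) : hyperreal :=
  projT1 (cid (hfun2_subproof f x y)).

Lemma hfun1P g x y :
  elt (opair (sval x) (sval y)) (star E (fun1_graph V g)) <-> y = hfun1 g x.
Proof. by rewrite /hfun1; case: cid. Qed.

Lemma hfun2P f x y z :
  elt (opair (opair (sval x) (sval y)) (sval z)) (star E (fun2_graph V f)) <->
  z = hfun2 f x y.
Proof. by rewrite /hfun2; case: cid. Qed.

Lemma hfun2_graph f x y :
  elt (opair (opair (sval x) (sval y)) (sval (hfun2 f x y)))
    (star E (fun2_graph V f)).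
Proof. exact/hfun2P. Qed.

Lemma hfun1_graph g x :
  elt (opair (sval x) (sval (hfun1 g x))) (star E (fun1_graph V g)).
Proof. exact/hfun1P. Qed.

Lemma hfun2C f : commutative f -> commutative (hfun2 f).
Proof.
move=> fC x y; apply/hfun2P.
have /= := ptransfer E (f :=
  (pAll 0 (pAll 1 (pAll 2 (pImp (pTriple 2 1 0 4) (pTriple 1 2 0 4))))))
  (e := params [:: reals V; fun2_graph V f]).
apply.
- move=> _ /elt_reals[r ->] _ /elt_reals[s ->] z _ /=.
  by rewrite !elt_fun2 fC.
- exact: svalP x.
- exact: svalP y.
- exact: svalP (hfun2 f x y).
- exact: hfun2_graph.
Qed.

Lemma hfun2A f : associative f -> associative (hfun2 f).
Proof.
move=> fA x y z; apply/hfun2P.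
have /= := ptransfer E (f :=
  (pAll 0 (pAll 1 (pAll 2 (pAll 3 (pAll 4 (pAll 5
    (pImp (pTriple 5 4 2 7) (pImp (pTriple 4 3 1 7)
      (pImp (pTriple 5 1 0 7) (pTriple 2 3 0 7)))))))))))
  (e := params [:: reals V; fun2_graph V f]).
apply.
- move=> _ /elt_reals[r ->] _ /elt_reals[s ->] _ /elt_reals[t ->].
  move=> a _ b _ c _ /=; rewrite !elt_fun2 => -> ->; rewrite !elt_fun2 => ->.
  by rewrite fA.
- exact: svalP x.
- exact: svalP y.
- exact: svalP z.
- exact: svalP (hfun2 f x y).
- exact: svalP (hfun2 f y z).
- exact: svalP (hfun2 f x (hfun2 f y z)).
- exact: hfun2_graph.
- exact: hfun2_graph.
- exact: hfun2_graph.
Qed.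

Lemma hfun2_1l f r : left_id r f -> left_id (star_real r) (hfun2 f).
Proof.
move=> f1 x; apply/esym/hfun2P.
have /= := ptransfer E (f :=
  (pAll 0 (pTriple 3 0 0 2)))
  (e := params [:: reals V; fun2_graph V f; real V r]).
apply; last exact: svalP x.
by move=> _ /elt_reals[s ->] /=; rewrite elt_fun2 f1.
Qed.

Lemma hfun2_invl f g s : left_inverse s g f ->
  left_inverse (star_real s) (hfun1 g) (hfun2 f).
Proof.
move=> fg x; apply/esym/hfun2P.
have /= := ptransfer E (f :=
  (pAll 0 (pAll 1 (pImp (pPair 1 0 4) (pTriple 0 1 5 3)))))
  (e := params [:: reals V; fun2_graph V f; fun1_graph V g; real V s]).
apply; [|exact: svalP x|exact: svalP (hfun1 g x)|exact: hfun1_graph].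
move=> _ /elt_reals[r ->] _ /elt_reals[t ->] /=.
by rewrite elt_fun1 => ->; rewrite elt_fun2 fg.
Qed.

Lemma hfun2Dl : left_distributive (hfun2 *%R) (hfun2 +%R).
Proof.
move=> x y z; apply/hfun2P.
have /= := ptransfer E (f :=
  (pAll 0 (pAll 1 (pAll 2 (pAll 3 (pAll 4 (pAll 5 (pAll 6
    (pImp (pTriple 6 5 3 9) (pImp (pTriple 3 4 2 8)
      (pImp (pTriple 6 4 1 8) (pImp (pTriple 5 4 0 8) (pTriple 1 0 2 9)))))))))))))
  (e := params [:: reals V; fun2_graph V *%R; fun2_graph V +%R]).
apply.
- move=> _ /elt_reals[r ->] _ /elt_reals[s ->] _ /elt_reals[t ->].
  move=> a _ b _ c _ d _ /=; rewrite !elt_fun2 => ->; rewrite !elt_fun2 => -> -> ->.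
  by rewrite elt_fun2 mulrDl.
- exact: svalP x.
- exact: svalP y.
- exact: svalP z.
- exact: svalP (hfun2 +%R x y).
- exact: svalP (hfun2 *%R (hfun2 +%R x y) z).
- exact: svalP (hfun2 *%R x z).
- exact: svalP (hfun2 *%R y z).
- exact: hfun2_graph.
- exact: hfun2_graph.
- exact: hfun2_graph.
- exact: hfun2_graph.
Qed.

Lemma star_inj : injective (star E).
Proof.
move=> a b h; apply/(transfer E (fEq 0 1) (params [:: a; b])).
exact: h.
Qed.

Lemma star_real_inj : injective star_real.
Proof. by move=> r s /(congr1 sval)/star_inj/real_inj. Qed.

Lemma hmulV (x : hyperreal) : x <> star_real 0 ->
  hfun2 *%R (hfun1 GRing.inv x) x = star_real 1.
Proof.
move=> x0; apply/esym/hfun2P.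
have /= := ptransfer E (f :=
  (pAll 0 (pAll 1 (pImp (pNot (pEq 1 5)) (pImp (pPair 1 0 4) (pTriple 0 1 6 3))))))
  (e := params [:: reals V; fun2_graph V *%R;
    fun1_graph V GRing.inv; real V 0; real V 1]).
apply.
- move=> _ /elt_reals[r ->] _ /elt_reals[t ->] /= r0.
  rewrite elt_fun1 => ->; rewrite elt_fun2 mulVf//.
  by apply/eqP => r0'; apply: r0; rewrite r0'.
- exact: svalP x.
- exact: svalP (hfun1 GRing.inv x).
- by move=> h; apply: x0; exact: hyperreal_inj.
- exact: hfun1_graph.
Qed.

Lemma hinv0 : hfun1 GRing.inv (star_real 0) = star_real 0.
Proof.
apply/esym/hfun1P.
have /= := ptransfer E (f :=
  (pPair 1 1 0))
  (e := params [:: fun1_graph V GRing.inv; real V 0]).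
by apply; rewrite /= elt_fun1 invr0.
Qed.

HB.instance Definition _ := gen_eqMixin hyperreal.
HB.instance Definition _ := gen_choiceMixin hyperreal.

HB.instance Definition _ := GRing.isZmodule.Build hyperreal
  (hfun2A (@addrA R)) (hfun2C (@addrC R)) (hfun2_1l (@add0r R))
  (hfun2_invl (@addNr R)).

Lemma hyperreal_oner_neq0 : star_real 1 != 0 :> hyperreal.
Proof. by apply/eqP => /star_real_inj/eqP; rewrite oner_eq0. Qed.

HB.instance Definition _ := GRing.Zmodule_isComNzRing.Build hyperreal
  (hfun2A (@mulrA R)) (hfun2C (@mulrC R)) (hfun2_1l (@mul1r R))
  hfun2Dl hyperreal_oner_neq0.

Lemma hyperreal_mulVf (x : hyperreal) :
  x != 0 -> (hfun1 GRing.inv x) * x = 1.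
Proof. by move=> /eqP; exact: hmulV. Qed.

HB.instance Definition _ := GRing.ComNzRing_isField.Build hyperreal
  hyperreal_mulVf hinv0.

Definition hlt (k K : hypernat) : Prop :=
  elt (opair (sval k) (sval K)) (star E (ltn_graph V)).

Definition hypersegment (K : hypernat) : Type := {k : hypernat | hlt k K}.

Lemma hyperseq_subproof u (k : hypernat) : exists z : hyperreal,
  forall y : hyperreal,
    elt (opair (sval k) (sval y)) (star E (seq_graph V u)) <-> y = z.
Proof.
have /= := ptransfer E (f :=
  (pAll 0 (pEx 3 (pAll 4 (pIff (pPair 2 0 4) (pEq 0 1))))))
  (e := params [:: nats V; seq_graph V u; reals V]).
move=> /(_ _ _ (svalP k)) [|z hz H].
  move=> _ /elt_nats[n ->]; exists (real V (u n)).
    by apply/elt_reals; exists (u n).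
  by move=> y _ /=; rewrite elt_seq.
exists (exist _ z hz) => y; rewrite (H _ (svalP y)).
by split=> [h|->//]; exact: hyperreal_inj.
Qed.

(* the extension *u : *N -> *R of a sequence u *)
Definition hyperseq u (k : hypernat) : hyperreal :=
  projT1 (cid (hyperseq_subproof u k)).

Lemma hyperseqP u k y :
  elt (opair (sval k) (sval y)) (star E (seq_graph V u)) <-> y = hyperseq u k.
Proof. by rewrite /hyperseq; case: cid. Qed.

Lemma hypersegment_inj (K : hypernat) (k l : hypersegment K) :
  sval (sval k) = sval (sval l) -> k = l.
Proof.
case: k l => [[k hk] kK] [[l hl] lK] /= kl; apply: eq_exist.
exact: eq_exist.
Qed.

(* the graph of f is an internal set *)
Definition internal_fun (K : hypernat) (v : hypersegment K -> hyperreal) : Prop :=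
  exists2 a : E, internal a &
    forall p, elt p a <-> exists k, p = opair (sval (sval k)) (sval (v k)).

Definition internal_pred (K : hypernat) : pred (hypersegment K -> hyperreal^o) :=
  fun v => `[< internal_fun v >].

Section HyperTuples.
Variable K : hypernat.
Local Notation F := (hypersegment K -> hyperreal^o).

Lemma internal_funP (v : F) (a : E) : internal a ->
  (forall p, elt p a -> exists2 k, elt k (star E (nats V)) &
     exists2 z, elt z (star E (reals V)) & p = opair k z) ->
  (forall k z : E, elt k (star E (nats V)) -> elt z (star E (reals V)) ->
     elt (opair k z) a -> elt (opair k (sval K)) (star E (ltn_graph V))) ->
  (forall (k : hypersegment K) (z : hyperreal),
     elt (opair (sval (sval k)) (sval z)) a <-> z = v k) ->
  internal_fun v.
Proof.
move=> aint arel aK af; exists a => // p; split=> [pa|[k ->]]; last exact/af.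
have [k hk [z hz pE]] := arel _ pa.
have kK : hlt (exist _ k hk) K by apply: (aK k z) => //; rewrite -pE.
pose l : hypersegment K := exist (fun l => hlt l K) _ kK.
pose y : hyperreal := exist _ z hz.
have ly : elt (opair (sval (sval l)) (sval y)) a by rewrite /= -pE.
by exists l; rewrite -(proj1 (af l y) ly).
Qed.

Lemma internal_trunc u :
  internal_fun (fun k : hypersegment K => hyperseq u (sval k)).
Proof.
have /= := ptransfer E (f :=
  (pAll 0 (pEx 3 (pAnd
    (pAll 0 (pEx 3 (pEx 5 (pIsPair 2 1 0))))
    (pAll 2 (pAll 4 (pIff (pPair 1 0 2) (pAnd (pPair 1 3 7) (pPair 1 0 8)))))))))
  (e := params [:: nats V; reals V; nat_real_rels V; ltn_graph V; seq_graph V u]).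
move=> /(_ _ _ (svalP K)) [|a ha [arel aE]].
  move=> _ /elt_nats[N ->].
  have [a ha [arel aE]] := nat_real_rel_ex V (fun n r => (n < N)%N /\ r = u n).
  exists a => //; split=> [p /arel[n [r ->]]|_ /elt_nats[n ->] _ /elt_reals[r ->]] /=.
    exists (real V n%:R); first by apply/elt_nats; exists n.
    by exists (real V r) => //; apply/elt_reals; exists r.
  rewrite aE elt_ltn elt_seq; split=> [[-> ->]//|[-> /real_inj]//].
apply: (@internal_funP _ a) => //.
- by exists (nat_real_rels V).
- by move=> k z hk hz; rewrite aE // => -[].
move=> k z; rewrite aE; [|exact: svalP (sval k)|exact: svalP z].
rewrite hyperseqP; split=> [[]//|->]; split=> //; exact: svalP k.
Qed.

Lemma internal_lin (c : hyperreal) (v w : F) : internal_fun v -> internal_fun w ->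
  internal_fun (c *: v + w).
Proof.
move=> [a [A aA] af] [b [B bB] bg].
have /= := ptransfer E (f :=
  (pAll 0 (pAll 2 (pAll 4 (pAll 6 (pEx 8 (pAnd
    (pAll 0 (pEx 8 (pEx 10 (pIsPair 2 1 0))))
    (pAll 7 (pAll 9 (pIff (pPair 1 0 2) (pAnd (pPair 1 4 12)
       (pEx 10 (pEx 11 (pEx 12 (pAnd (pPair 4 2 9) (pAnd (pPair 4 1 8)
          (pAnd (pTriple 6 2 0 16) (pTriple 0 1 3 17))))))))))))))))))
  (e := params [:: A; B; nats V; reals V; nat_real_rels V; ltn_graph V;
    fun2_graph V *%R; fun2_graph V +%R]).
move=> /(_ _ _ aA _ bB _ (svalP K) _ (svalP c)) [|h hh [hrel hE]].
  move=> a' _ b' _ _ /elt_nats[N ->] _ /elt_reals[t ->].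
  have [h hh [hrel hE]] := nat_real_rel_ex V (fun n r => (n < N)%N /\
     exists x y, elt (opair (real V n%:R) (real V x)) a' /\
       elt (opair (real V n%:R) (real V y)) b' /\ r = t * x + y).
  exists h => //; split=> [p /hrel[n [r ->]]|_ /elt_nats[n ->] _ /elt_reals[r ->]] /=.
    exists (real V n%:R); first by apply/elt_nats; exists n.
    by exists (real V r) => //; apply/elt_reals; exists r.
  rewrite hE elt_ltn; split=> -[-> ] H; split=> //.
    have [x [y [xa [yb ->]]]] := H.
    exists (real V x); first by apply/elt_reals; exists x.
    exists (real V y); first by apply/elt_reals; exists y.
    exists (real V (t * x)); first by apply/elt_reals; exists (t * x).
    by rewrite !elt_fun2.
  case: H => _ /elt_reals[x ->] [_ /elt_reals[y ->] [_ /elt_reals[z ->]]].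
  move=> [xa [yb [/elt_fun2/real_inj -> /elt_fun2/real_inj ->]]].
  by exists x, y.
have afE (k : hypersegment K) (x : hyperreal) :
    elt (opair (sval (sval k)) (sval x)) a -> x = v k.
  move=> /af [k' /opair_inj[kk' /hyperreal_inj ->]]; congr v.
  by apply: hypersegment_inj; exact: esym.
have bgE (k : hypersegment K) (x : hyperreal) :
    elt (opair (sval (sval k)) (sval x)) b -> x = w k.
  move=> /bg [k' /opair_inj[kk' /hyperreal_inj ->]]; congr w.
  by apply: hypersegment_inj; exact: esym.
apply: (@internal_funP _ h) => //.
- by exists (nat_real_rels V).
- by move=> k z hk hz; rewrite hE // => -[].
move=> k z; rewrite hE; [|exact: svalP (sval k)|exact: svalP z].
split=> [[_ [x hx [y hy [t ht [xa [yb [/= mE dE]]]]]]]|->].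
  have /hfun2P tE := mE : elt (opair (opair (sval c) (sval (exist _ x hx : hyperreal)))
    (sval (exist _ t ht : hyperreal))) _.
  have /hfun2P zE := dE : elt (opair (opair (sval (exist _ t ht : hyperreal))
    (sval (exist _ y hy : hyperreal))) (sval z)) _.
  have xE := afE k (exist _ x hx) xa; have yE := bgE k (exist _ y hy) yb.
  by rewrite zE tE xE yE.
split; first exact: svalP k.
exists (sval (v k)); first exact: svalP (v k).
exists (sval (w k)); first exact: svalP (w k).
exists (sval (c * v k)); first exact: svalP (hfun2 *%R c (v k)).
split; first by apply/af; exists k.
split; first by apply/bg; exists k.
by split; exact: hfun2_graph.
Qed.

Lemma internal_pred_submod : submod_closed (@internal_pred K).
Proof.
split=> [|c v w /asboolP hv /asboolP hw]; apply/asboolP; last exact: internal_lin.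
pose h : F := fun k => hyperseq (fun=> 0) (sval k).
have hint : internal_fun h := internal_trunc (fun=> 0).
have <- : -1 *: h + h = 0 by rewrite scaleN1r addNr.
exact: internal_lin.
Qed.

HB.instance Definition _ := GRing.isSubmodClosed.Build hyperreal F
  (@internal_pred K) (GRing.submod_closed_semi internal_pred_submod).

(* *R^K: the internal functions {k in *N | k < K} -> *R *)
Record hypertuple := HyperTuple {
  hypertuple_val : F;
  hypertuple_internal : internal_pred hypertuple_val }.

HB.instance Definition _ := [isSub for hypertuple_val].
HB.instance Definition _ := [Choice of hypertuple by <:].
HB.instance Definition _ := [SubChoice_isSubLmodule of hypertuple by <:].

Lemma hypertrunc_subproof u :
  internal_pred (fun k : hypersegment K => hyperseq u (sval k) : hyperreal^o).
Proof. by apply/asboolP; exact: internal_trunc. Qed.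

(* x_(K), the restriction of *x to {k in *N | k < K} *)
Definition hypertrunc u : hypertuple := HyperTuple (hypertrunc_subproof u).

End HyperTuples.
End Hyperreals.

(* x_(m); sequences are indexed from 0, so its coordinates are x 0, ..., x m.-1. *)
Definition trunc (R : realType) (m : nat) (x : nat -> R) : 'rV[R]_m :=
  \row_(k < m) x k.

(* Main.v *)
(** The matrices [(u_i(k))_(i < gamma, k < m)] have ranks that are nondecreasing
    in [m] and bounded by [gamma]; a row vector killed by one of maximal rank is
    killed by all larger ones, hence gives a linear relation between the
    sequences. So some [m] yields a matrix with a right inverse [B]. Every
    hyperfinite [K] exceeds [m], and the image of [B] under the field embedding
    R -> *R solves for the coefficients of any *R-linear relation between the
    truncations at [K] from its first [m] coordinates. *)
Require Import Defs.
From mathcomp Require Import all_boot all_order all_algebra.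
From mathcomp Require Import all_classical all_reals all_analysis.

Set Implicit Arguments.
Unset Strict Implicit.
Unset Printing Implicit Defensive.

Import GRing.Theory.

Local Open Scope classical_set_scope.
Local Open Scope ring_scope.

Section StandardTruncation.
Variables (R : realType) (gamma : nat) (u : 'I_gamma -> nat -> R).

(** Its rows are the truncations at [m], so its left kernel is the space of linear relations between
    them. *)
Definition trunc_mx (m : nat) : 'M[R]_(gamma, m) := \matrix_(i, k) u i k.

Lemma mul_trunc_mx_eq0 (m : nat) (c : 'rV[R]_gamma) :
  (c *m trunc_mx m = 0) <->
  (forall k, (k < m)%N -> \sum_(i < gamma) c 0 i * u i k = 0).
Proof.
split=> [/rowP c0 k km|c0].
  have := c0 (Ordinal km); rewrite !mxE => c0k; rewrite -[RHS]c0k.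
  by apply: eq_bigr => i _; rewrite mxE.
apply/rowP => k; rewrite !mxE -[RHS](c0 k (ltn_ord k)).
by apply: eq_bigr => i _; rewrite mxE.
Qed.

Lemma kermx_trunc_mxS (m n : nat) : (m <= n)%N ->
  (kermx (trunc_mx n) <= kermx (trunc_mx m))%MS.
Proof.
move=> mn; apply/rV_subP => c /sub_kermxP/mul_trunc_mx_eq0 c0.
apply/sub_kermxP/mul_trunc_mx_eq0 => k km.
by apply: c0; exact: leq_trans mn.
Qed.

Lemma row_free_trunc_mx : lin_indep u -> exists m, row_free (trunc_mx m).
Proof.
move=> hu; pose P r := `[< exists m, \rank (trunc_mx m) = r >].
have exP : exists r, P r by exists (\rank (trunc_mx 0)); apply/asboolP; exists 0%N.
have leP r : P r -> (r <= gamma)%N by move=> /asboolP[m <-]; exact: rank_leq_row.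
case: (ex_maxnP exP leP) => _ /asboolP[m <-] rmax; exists m.
rewrite -kermx_eq0; apply/eqP/row_matrixP => j; rewrite row0.
set c := row j _.
(* A relation at the width [m] of maximal rank holds at every width: for [n >= m] the kernels are
   nested, and maximality of the rank forces equal dimensions. *)
have cker n : (c <= kermx (trunc_mx n))%MS.
  apply: submx_trans (row_sub j _) _.
  have [mn|/ltnW nm] := leqP m n; last exact: kermx_trunc_mxS.
  have nm_ker := kermx_trunc_mxS mn.
  rewrite -(geq_leqif (mxrank_leqif_sup nm_ker)) !mxrank_ker leq_sub2l//.
  by apply: rmax; apply/asboolP; exists n.
apply/rowP => i; rewrite [RHS]mxE; apply: (hu (fun i => c 0 i)).
apply/funext => k; rewrite fct_sumE.
(* Column [k] is present only from width [k.+1] on. *)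
by have /sub_kermxP/mul_trunc_mx_eq0/(_ k (ltnSn k)) := cker k.+1.
Qed.

Lemma row_free_lin_indep_trunc (m n : nat) : row_free (trunc_mx m) ->
  (m <= n)%N -> lin_indep (fun i => trunc n (u i)).
Proof.
move=> mfree mn c c0 i.
have cker : (\row_i c i) *m trunc_mx m = 0.
  apply/mul_trunc_mx_eq0 => k km.
  have /rowP/(_ (Ordinal (leq_trans km mn))) := c0.
  rewrite summxE mxE => c0k; rewrite -[RHS]c0k.
  by apply: eq_bigr => l _; rewrite !mxE.
have /rowP/(_ i) : \row_i c i = 0.
  by apply: (row_free_inj mfree); rewrite cker mul0mx.
by rewrite !mxE.
Qed.

End StandardTruncation.

Section Extension.
Variables (R : realType) (V : real_superstructure R).
Variable E : nonstandard_extension V.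

(** Transfer of one membership in the graph of [f]; for [+] and [*] it makes [star_real] a ring
    embedding. *)
Lemma hfun2_star_real (f : R -> R -> R) (r s : R) :
  hfun2 f (star_real E r) (star_real E s) = star_real E (f r s).
Proof.
apply/esym/hfun2P.
apply: (ptransfer E (f := pTriple 0 1 2 3)
  (e := params [:: real V r; real V s; real V (f r s); fun2_graph V f])).
exact/elt_fun2.
Qed.

Lemma star_realD (r s : R) :
  star_real E (r + s) = star_real E r + star_real E s.
Proof. by rewrite -hfun2_star_real. Qed.

Lemma star_realM (r s : R) :
  star_real E (r * s) = star_real E r * star_real E s.
Proof. by rewrite -hfun2_star_real. Qed.

Lemma star_real_sum (n : nat) (F : 'I_n -> R) :
  star_real E (\sum_(i < n) F i) = \sum_(i < n) star_real E (F i).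
Proof. exact: (big_morph _ star_realD). Qed.

Lemma hyperseq_star_nat (x : nat -> R) (n : nat) :
  hyperseq x (star_nat E n) = star_real E (x n).
Proof.
apply/esym/hyperseqP.
apply: (ptransfer E (f := pPair 0 1 2)
  (e := params [:: real V n%:R; real V (x n); seq_graph V x])).
exact/elt_seq.
Qed.

Lemma hypernat_inj (k l : hypernat E) : sval k = sval l -> k = l.
Proof. by case: k l => [k hk] [l hl] /= kl; exact: eq_exist. Qed.

Lemma hlt0 (K : hypernat E) : K <> star_nat E 0 -> hlt (star_nat E 0) K.
Proof.
move=> K0.
have /= := ptransfer E (f := pAll 0 (pImp (pNot (pEq 0 2)) (pPair 2 0 3)))
  (e := params [:: nats V; real V 0%:R; ltn_graph V]).
apply; [|exact: svalP K|by move=> h; apply: K0; exact: hypernat_inj].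
move=> _ /elt_nats[k ->] /= k0; apply/elt_ltn; rewrite lt0n.
by apply/eqP => k0'; apply: k0; rewrite k0'.
Qed.

(** Transfer, for one fixed [n], of the fact that the least natural number above [n] is [n.+1]. *)
Lemma hltS (n : nat) (K : hypernat E) : hlt (star_nat E n) K ->
  K <> star_nat E n.+1 -> hlt (star_nat E n.+1) K.
Proof.
move=> nK KS.
have /= := ptransfer E (f :=
  pAll 0 (pImp (pPair 2 0 4) (pImp (pNot (pEq 0 3)) (pPair 3 0 4))))
  (e := params [:: nats V; real V n%:R; real V n.+1%:R; ltn_graph V]).
apply; [|exact: svalP K|exact: nK|by move=> h; apply: KS; exact: hypernat_inj].
move=> _ /elt_nats[k ->] /elt_ltn /= nk kS; apply/elt_ltn.
by rewrite ltn_neqAle nk andbT; apply/eqP => kS'; apply: kS; rewrite kS'.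
Qed.

(** External induction on the standard [n]: [K] differs from each standard number, so it passes them
    one at a time. *)
Lemma hyperfinite_gt (K : hypernat E) (n : nat) :
  hyperfinite K -> hlt (star_nat E n) K.
Proof.
move=> hK; elim: n => [|n IHn]; first by apply: hlt0 => K0; apply: hK; exists 0%N.
by apply: hltS => // KS; apply: hK; exists n.+1.
Qed.

Lemma hypertuple_val_lin (K : hypernat E) (n : nat) (c : 'I_n -> hyperreal E)
    (v : 'I_n -> hypertuple K) (k : hypersegment K) :
  hypertuple_val (\sum_(i < n) c i *: v i) k =
  \sum_(i < n) c i * hypertuple_val (v i) k.
Proof.
(* The additive structure is attached to [val]. *)
rewrite -[hypertuple_val _]/(val _) raddf_sum fct_sumE.
exact: eq_bigr.
Qed.

(** Evaluation at the standard coordinate [n], where the extension of [u i] takes the value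
    [u i n]. *)
Lemma hypertrunc_relation (gamma : nat) (u : 'I_gamma -> nat -> R)
    (K : hypernat E) (c : 'I_gamma -> hyperreal E) (n : nat) :
  hlt (star_nat E n) K -> \sum_(i < gamma) c i *: hypertrunc K (u i) = 0 ->
  \sum_(i < gamma) c i * star_real E (u i n) = 0.
Proof.
move=> nK c0; pose k : hypersegment K := exist (fun l => hlt l K) _ nK.
have := hypertuple_val_lin c (fun i => hypertrunc K (u i)) k.
rewrite c0 -[hypertuple_val 0]/(val _) raddf0 => h; rewrite [RHS]h.
by apply: eq_bigr => i _; rewrite -hyperseq_star_nat.
Qed.

End Extension.

Theorem lemmaA1 (R : realType) (gamma : nat) (u : 'I_gamma -> nat -> R)
    (hu : @lin_indep R (nat -> R) gamma u) :
  (forall (V : real_superstructure R) (E : nonstandard_extension V),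
    countably_saturated E ->
    forall K : hypernat E, hyperfinite K ->
      lin_indep (fun i : 'I_gamma => hypertrunc K (u i))) /\
  (\forall m \near \oo, lin_indep (fun i : 'I_gamma => trunc m (u i))).
Proof.
have [m mfree] := row_free_trunc_mx hu.
split=> [V E _ K hK c c0 j|]; last first.
  by exists m => // n /= mn; exact: row_free_lin_indep_trunc mfree mn.
(* Since the rows are free, the pseudo-inverse is a right inverse. *)
pose B := pinvmx (trunc_mx u m).
have uB i : \sum_(k < m) u i k * B k j = (i == j)%:R.
  have /matrixP/(_ i j) := mulmxVp mfree; rewrite !mxE => <-.
  by apply: eq_bigr => k _; congr (_ * _); rewrite mxE.
(* The first [m] coordinates of the relation, weighted by column [j] of [B]; exchanging the sums
   isolates [c j]. *)
have : \sum_(k < m) (\sum_(i < gamma) c i * star_real E (u i k)) *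
    star_real E (B k j) = 0.
  apply: big1 => k _.
  by rewrite (hypertrunc_relation (hyperfinite_gt k hK) c0) mul0r.
under eq_bigr do rewrite mulr_suml.
have sum_k i : \sum_(k < m) c i * star_real E (u i k) * star_real E (B k j) =
    c i * star_real E (i == j)%:R.
  under eq_bigr do rewrite -mulrA -star_realM.
  by rewrite -mulr_sumr -star_real_sum uB.
rewrite exchange_big; under eq_bigr do rewrite sum_k.
(* Only [i = j] survives; the hyperreal 0 and 1 are by definition [star_real] of 0 and 1. *)
rewrite (bigD1 j)//= eqxx big1 => [|i /negbTE ->]; last exact: mulr0.
by rewrite addr0 => <-; rewrite [RHS]mulr1.
Qed.
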